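(* Let $(P_0,p_0),(P_1,p_1),(P_2,p_2),(P_3,p_3)$ be general pairs, where each $P_i\in\mathbb{R}^3$ and each $p_i\in\mathbb{R}^3$ is a canvas point, i.e. lies on the plane $z=1$. Suppose that none of the $p_i$ is orthogonal to $p_3$ and that there exists a rigid transformation $T$ of $\mathbb{R}^3$ such that for each $i$ we have $T(P_i)\ne 0$ and $T(P_i)$ lies on the line connecting the origin to $p_i$, with all $T(P_i)$ in front of the camera (that is, having positive $z$-coordinate). Then, in exact arithmetic, the Four-Point Algorithm described in the context, applied to $(P_i,p_i)_{i=0,\dots,3}$, outputs numbers $z^{\mathrm{orig}}_0,z^{\mathrm{orig}}_1,z^{\mathrm{orig}}_2,z^{\mathrm{orig}}_3$ such that $T(P_i)=z^{\mathrm{orig}}_i\,p_i$ for each $i$.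
   Context: ''General'' means: there is a nonzero polynomial $F$ on $(\mathbb{R}^3)^4$ such that the conclusion holds for all tuples and all $T$ as in the hypotheses with $F(T(P_0),T(P_1),T(P_2),T(P_3))\neq 0$. \textbf{Four-Point Algorithm.} Input: $(P_i,p_i)_{i=0,\dots,3}$ with $P_i\in\mathbb{R}^3$, $p_i$ on the plane $z=1$ in $\mathbb{R}^3$, and $p_i\cdot p_3\ne0$ for each $i$. For $i\in\{0,1,2\}$ the indices $j,k\in\{0,1,2\}$ are determined by $j\equiv i+1\pmod 3$, $k\equiv j+1\pmod 3$. (1) For $i=0,1,2$ compute $$a_i=\|P_j-P_k\|^2,\quad c_i=\|P_i-P_3\|^2,\quad b_i=\frac{(p_i\cdot p_i)(p_3\cdot p_3)}{(p_i\cdot p_3)^2},\quad d_i=\frac{(p_j\cdot p_k)(p_3\cdot p_3)}{(p_j\cdot p_3)(p_k\cdot p_3)}.$$ (2) Compute the coefficients $X_{i,j}$ ($i=0,1,2,3$; $j=0,1,2$) from the formulas given below. (3) Form the polynomials $Q_i(x)=X_{i,2}x^2+X_{i,1}x+X_{i,0}$ for $0\le i\le3$ and compute all $16$ quadruples $(\alpha_0,\alpha_1,\alpha_2,\alpha_3)$ where each $\alpha_i$ is a root of $Q_i$. (4) For each of these quadruples let $z_3=\sqrt{\alpha_3}$ and, for $i<3$, let $z_i=\pm\sqrt{\alpha_i}$ with sign chosen to agree with the sign of $p_i\cdot p_3$ (if some $\alpha_i$ is not a nonnegative real number, $\sqrt{\alpha_i}$ is a complex square root). (5) Among the $16$ quadruples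 $(z_0,z_1,z_2,z_3)$ choose the one minimizing the error in the six equations $$a_i=b_jz_j^2+b_kz_k^2-2d_iz_jz_k,\qquad c_i=z_3^2+b_iz_i^2-2z_iz_3\qquad(i=0,1,2),$$ where the error is measured by a fixed nonnegative function of the six discrepancies (e.g. the sum of their absolute values) that is zero exactly when all six equations hold. (6) Output $z^{\mathrm{orig}}_i=\dfrac{\|p_3\|}{p_i\cdot p_3}\,z_i$ for $i=0,1,2,3$. \textbf{Formulas for the $X_{i,j}$.} The polynomials $X_{0,0},X_{0,1},X_{0,2},X_{3,0},X_{3,1},X_{3,2}$ are written below as X00, X01, X02, X30, X31, X32 in plain text: the symbols c0, a1, b2, d0, etc. stand for $c_0,a_1,b_2,d_0$, etc.; juxtaposition means multiplication; and a caret means exponentiation of the single variable preceding it (so 2c0a0a2b1d0d1 is $2c_0a_0a_2b_1d_0d_1$ and c0^2a0b1d0d1 is $c_0^2a_0b_1d_0d_1$). Line breaks inside one formula have no meaning. \begin{verbatim} X00 = c0^2a0b1d0d1-2c0c1a0b1d0d1+c1^2a0b1d0d1+c0^2a1b1d0d1-2c0c1a1b1d0d1+c1^2a1b1d0d1-c0^2a2b1d0d1+2c0c1a2b1d0d1-c1^2a2b1d0d1 +2c0a0a2b1d0d1-2c1a0a2b1d0d1+2c0a1a2b1d0d1-2c1a1a2b1d0d1-2c0a2^2b1d0d1+2c1a2^2b1d0d1+a0a2^2b1d0d1+a1a2^2b1d0d1-a2^3b1d0d1 -c0^2a0b1b2d2+2c0c1a0b1b2d2-c1^2a0b1b2d2-c0a0^2b1b2d2+c1a0^2b1b2d2+c0^2a1b1b2d2-2c0c1a1b1b2d2+c1^2a1b1b2d2+2c0a0a1b1b2d2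 -2c1a0a1b1b2d2-c0a1^2b1b2d2+c1a1^2b1b2d2+c0^2a2b1b2d2-2c0c1a2b1b2d2+c1^2a2b1b2d2-a0^2a2b1b2d2+2a0a1a2b1b2d2-a1^2a2b1b2d2 +c0a2^2b1b2d2-c1a2^2b1b2d2+a0a2^2b1b2d2-a1a2^2b1b2d2-2c0^2a1d0^2d2+4c0c1a1d0^2d2-2c1^2a1d0^2d2+2a1a2^2d0^2d2-c0a0^2b1b2 -c1a0^2b1b2+2c0a0a1b1b2+2c1a0a1b1b2-c0a1^2b1b2-c1a1^2b1b2+2c0a0a2b1b2+2c1a0a2b1b2+a0^2a2b1b2-2c0a1a2b1b2-2c1a1a2b1b2 -2a0a1a2b1b2+a1^2a2b1b2-c0a2^2b1b2-c1a2^2b1b2-2a0a2^2b1b2+2a1a2^2b1b2+a2^3b1b2+4c0a1a2d0^2+4c1a1a2d0^2-4a1a2^2d0^2 -4c0a0a2d0d1-4c0a1a2d0d1+4c0a2^2d0d1+2c0a0^2b2d2-4c0a0a1b2d2+2c0a1^2b2d2-2c0a2^2b2d2 X01 = -4c0a0b0b1d0d1+4c1a0b0b1d0d1-4c0a1b0b1d0d1+4c1a1b0b1d0d1+4c0a2b0b1d0d1-4c1a2b0b1d0d1-4a0a2b0b1d0d1-4a1a2b0b1d0d1+4a2^2b0b1d0d1 -2c0^2b0b1b2d2+4c0c1b0b1b2d2-2c1^2b0b1b2d2+2a0^2b0b1b2d2-4a0a1b0b1b2d2+2a1^2b0b1b2d2-4c0a2b0b1b2d2+4c1a2b0b1b2d2-4a0a2b0b1b2d2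 +4a1a2b0b1b2d2+2c0^2b0d0^2d2-4c0c1b0d0^2d2+2c1^2b0d0^2d2+4c0a1b0d0^2d2-4c1a1b0d0^2d2-4a1a2b0d0^2d2-2a2^2b0d0^2d2+2c0^2b1d1^2d2 -4c0c1b1d1^2d2+2c1^2b1d1^2d2+4c0a0b1d1^2d2-4c1a0b1d1^2d2+4a0a2b1d1^2d2-2a2^2b1d1^2d2-4c0^2d0d1d2^2+8c0c1d0d1d2^2-4c1^2d0d1d2^2 +4a0a2d0d1d2^2+4a1a2d0d1d2^2+2c0^2b2d2^3-4c0c1b2d2^3+2c1^2b2d2^3-2a0^2b2d2^3+4a0a1b2d2^3-2a1^2b2d2^3-4c0a0b0b1b2-4c1a0b0b1b2 +4c0a1b0b1b2+4c1a1b0b1b2+4c0a2b0b1b2+4c1a2b0b1b2+4a0a2b0b1b2-4a1a2b0b1b2-4a2^2b0b1b2-4c0a1b0d0^2-4c1a1b0d0^2-4c0a2b0d0^2 -4c1a2b0d0^2+4a1a2b0d0^2+4a2^2b0d0^2+4c0a0b0d0d1+4c0a1b0d0d1-4c0a2b0d0d1+4a0a2b0d0d1+4a1a2b0d0d1-4a2^2b0d0d1-4c1a0b1d0d1 -4c1a1b1d0d1+4c1a2b1d0d1+4a0a2b1d0d1+4a1a2b1d0d1-4a2^2b1d0d1+4c0a0b1d1^2+4c1a0b1d1^2-4c0a2b1d1^2-4c1a2b1d1^2-4a0a2b1d1^2 +4a2^2b1d1^2+4c0a0b0b2d2-2a0^2b0b2d2-4c0a1b0b2d2+4a0a1b0b2d2-2a1^2b0b2d2+4c0a2b0b2d2+2a2^2b0b2d2+4c1a0b1b2d2-2a0^2b1b2d2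 -4c1a1b1b2d2+4a0a1b1b2d2-2a1^2b1b2d2-4c1a2b1b2d2+2a2^2b1b2d2+8c1a1d0^2d2+8c0a2d0d1d2+8c1a2d0d1d2-8a0a2d0d1d2-8a1a2d0d1d2 -8c0a0d1^2d2+4a0^2b2d2^2-8a0a1b2d2^2+4a1^2b2d2^2-4c0a2b2d2^2-4c1a2b2d2^2 X02 = 4a0b0^2b1d0d1+4a1b0^2b1d0d1-4a2b0^2b1d0d1+4c0b0^2b1b2d2-4c1b0^2b1b2d2+4a0b0^2b1b2d2-4a1b0^2b1b2d2-4c0b0^2d0^2d2 +4c1b0^2d0^2d2+4a2b0^2d0^2d2-4c0b0b1d1^2d2+4c1b0b1d1^2d2-8a0b0b1d1^2d2+4a2b0b1d1^2d2+8c0b0d0d1d2^2-8c1b0d0d1d2^2-4a0b0d0d1d2^2 -4a1b0d0d1d2^2-4a2b0d0d1d2^2-4c0b0b2d2^3+4c1b0b2d2^3-4a0b0b2d2^3+4a1b0b2d2^3+8a0d1^2d2^3-4c0b0^2b1b2-4c1b0^2b1b2+4a2b0^2b1b2 +4c0b0^2d0^2+4c1b0^2d0^2-4a2b0^2d0^2-4a0b0^2d0d1-4a1b0^2d0d1+4a2b0^2d0d1-4a0b0b1d0d1-4a1b0b1d0d1+4a2b0b1d0d1+4c0b0b1d1^2 +4c1b0b1d1^2-4a2b0b1d1^2-4a0b0^2b2d2+4a1b0^2b2d2-4a2b0^2b2d2+8c1b0b1b2d2-4a0b0b1b2d2+4a1b0b1b2d2-4a2b0b1b2d2-8c1b0d0^2d2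 -8c0b0d0d1d2-8c1b0d0d1d2+8a0b0d0d1d2+8a1b0d0d1d2+8a0b0d1^2d2-8c1b1d1^2d2+8a0b1d1^2d2+4c0b0b2d2^2+4c1b0b2d2^2+8a0b0b2d2^2 -8a1b0b2d2^2+4a2b0b2d2^2+16c1d0d1d2^2-16a0d1^2d2^2-8c1b2d2^3 X30 = c0^2c1b0b1b2+c0c1^2b0b1b2-c0^2c2b0b1b2+c1^2c2b0b1b2-c0c2^2b0b1b2-c1c2^2b0b1b2+c0^2a1b0b1b2-c1^2a1b0b1b2+2c0c2a1b0b1b2 +2c1c2a1b0b1b2-c0a1^2b0b1b2-c1a1^2b0b1b2-c0^2a2b0b1b2-2c0c1a2b0b1b2-2c1c2a2b0b1b2+c2^2a2b0b1b2+2c1a1a2b0b1b2-2c2a1a2b0b1b2 +a1^2a2b0b1b2+c0a2^2b0b1b2+c2a2^2b0b1b2-a1a2^2b0b1b2-c0^3b0b1d1-2c0^2c1b0b1d1-c0c1^2b0b1d1+c0^2c2b0b1d1+2c0c1c2b0b1d1+c1^2c2b0b1d1 +c0^2a1b0b1d1+2c0c1a1b0b1d1+c1^2a1b0b1d1+2c0^2a2b0b1d1+2c0c1a2b0b1d1-2c0c2a2b0b1d1-2c1c2a2b0b1d1-2c0a1a2b0b1d1-2c1a1a2b0b1d1 -c0a2^2b0b1d1+c2a2^2b0b1d1+a1a2^2b0b1d1+2c0^2c2b1d1^2-2c1^2c2b1d1^2+4c1c2a2b1d1^2-2c2a2^2b1d1^2+c0^3b0b2d2-c0^2c1b0b2d2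 +2c0^2c2b0b2d2-2c0c1c2b0b2d2+c0c2^2b0b2d2-c1c2^2b0b2d2-2c0^2a1b0b2d2+2c0c1a1b0b2d2-2c0c2a1b0b2d2+2c1c2a1b0b2d2+c0a1^2b0b2d2 -c1a1^2b0b2d2-c0^2a2b0b2d2-2c0c2a2b0b2d2-c2^2a2b0b2d2+2c0a1a2b0b2d2+2c2a1a2b0b2d2-a1^2a2b0b2d2-4c0^2c2d1^2d2+4c0c1c2d1^2d2 +4c0c2a2d1^2d2-2c0^2c1b2d2^2+2c1c2^2b2d2^2-4c1c2a1b2d2^2+2c1a1^2b2d2^2+4c0^2c1d1d2^2-4c0c1c2d1d2^2-4c0c1a1d1d2^2 X31 = -4c0c1b0b1b2-2c1^2b0b1b2+4c0c2b0b1b2+2c2^2b0b1b2-4c0a1b0b1b2-4c2a1b0b1b2+2a1^2b0b1b2+4c0a2b0b1b2+4c1a2b0b1b2-2a2^2b0b1b2 +4c0^2b0b1d1+4c0c1b0b1d1-4c0c2b0b1d1-4c1c2b0b1d1-4c0a1b0b1d1-4c1a1b0b1d1-4c0a2b0b1d1+4c2a2b0b1d1+4a1a2b0b1d1-2c0^2b1d1^2 +2c1^2b1d1^2-4c0c2b1d1^2+4c1c2b1d1^2-4c1a2b1d1^2-4c2a2b1d1^2+2a2^2b1d1^2-4c0^2b0b2d2+4c0c1b0b2d2-4c0c2b0b2d2+4c1c2b0b2d2 +4c0a1b0b2d2-4c1a1b0b2d2+4c0a2b0b2d2+4c2a2b0b2d2-4a1a2b0b2d2+4c0^2d1^2d2-4c0c1d1^2d2+4c0c2d1^2d2-4c1c2d1^2d2-4c0a2d1^2d2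 -4c2a2d1^2d2+2c0^2b2d2^2+4c0c1b2d2^2-4c1c2b2d2^2-2c2^2b2d2^2+4c1a1b2d2^2+4c2a1b2d2^2-2a1^2b2d2^2-4c0^2d1d2^2-4c0c1d1d2^2 +4c0c2d1d2^2+4c1c2d1d2^2+4c0a1d1d2^2+4c1a1d1d2^2-2c0^2b0b1+2c1^2b0b1+4c0a1b0b1+4c1a1b0b1-4c1a2b0b1-4a1a2b0b1+2a2^2b0b1 +2c0^2b0b2-2c2^2b0b2+4c2a1b0b2-2a1^2b0b2-4c0a2b0b2-4c2a2b0b2+4a1a2b0b2+2c1^2b1b2-2c2^2b1b2+4c2a1b1b2-2a1^2b1b2-4c1a2b1b2+2a2^2b1b2 -4c0^2b0d1+4c0c2b0d1+4c0a1b0d1+4c0a2b0d1-4c2a2b0d1-4a1a2b0d1-4c1^2b1d1+4c0c2b1d1+4c0a1b1d1+8c1a2b1d1-4a2^2b1d1+8c2a2d1^2+4c0^2b0d2 -4c0c1b0d2-4c0a1b0d2+4c1a1b0d2-4c0a2b0d2+4a1a2b0d2-4c0c1b2d2+4c2^2b2d2-8c2a1b2d2+4a1^2b2d2-4c0a2b2d2+8c0c1d1d2-8c0c2d1d2 -8c0a1d1d2+8c0a2d1d2-8c1a1d2^2 X32 = 4c1b0b1b2-4c2b0b1b2+4a1b0b1b2-4a2b0b1b2-4c0b0b1d1+4c2b0b1d1+4a1b0b1d1+4c0b1d1^2-4c1b1d1^2+4a2b1d1^2+4c0b0b2d2-4c1b0b2d2 -4a2b0b2d2-4c0d1^2d2+4c1d1^2d2+4a2d1^2d2-4c0b2d2^2+4c2b2d2^2-4a1b2d2^2+4c0d1d2^2-4c2d1d2^2-4a1d1d2^2+4c0b0b1-4c1b0b1-8a1b0b1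 +4a2b0b1-4c0b0b2+4c2b0b2-4a1b0b2+8a2b0b2-4c1b1b2+4c2b1b2-4a1b1b2+4a2b1b2+4c0b0d1-4c2b0d1-4a1b0d1-4c0b1d1+8c1b1d1-4c2b1d1-4a1b1d1 -8a2b1d1-8a2d1^2-4c0b0d2+4c1b0d2+4a2b0d2+4c0b2d2+4c1b2d2-8c2b2d2+8a1b2d2+4a2b2d2-8c1d1d2+8c2d1d2+8a1d1d2-8a2d1d2+8a1d2^2 +8a1b0-8a2b0+8a1b1-8a2b2+16a2d1-16a1d2 \end{verbatim} For $j=0,1,2$, $X_{1,j}$ is obtained from $X_{0,j}$ by swapping the indices $0$ and $1$ on every variable $a_\bullet,b_\bullet,c_\bullet,d_\bullet$ occurring in it, and $X_{2,j}$ is obtained from $X_{0,j}$ by swapping the indices $0$ and $2$ on every variable occurring in it. *)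

(* Defs.v *)
From mathcomp Require Import all_boot all_order all_algebra all_fingroup.
From mathcomp Require Import reals complex mpoly.

Set Implicit Arguments.
Unset Strict Implicit.
Unset Printing Implicit Defensive.

Import Order.TTheory GRing.Theory Num.Theory.
Local Open Scope ring_scope.
Local Open Scope complex_scope.

Section Euclidean.
Context {R : realType}.
Implicit Types (u v : 'rV[R]_3) (T : 'rV[R]_3 -> 'rV[R]_3).

Definition dot u v : R := \sum_(k < 3) u 0 k * v 0 k.

Definition norm2 u : R := Num.sqrt (dot u u).

(* Orientation-reversing isometries are included. *)
Definition rigid_transformation T : Prop :=
  forall u v, norm2 (T u - T v) = norm2 (u - v).

(* Column [ord_max] of a row vector of size 3 is the z-coordinate. *)
Definition zcoord u : R := u 0 ord_max.

Definition canvas_point u : Prop := zcoord u = 1.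

(* The twelve coordinates of a quadruple of points, as a point at which a
   polynomial on (R^3)^4 can be evaluated. *)
Definition coords (q : 'I_4 -> 'rV[R]_3) : 'I_(4 * 3) -> R :=
  mxvec (\matrix_(i < 4, k < 3) q i 0 k) 0.

End Euclidean.

Definition X00 {K : comNzRingType}
    (a0 a1 a2 b0 b1 b2 c0 c1 c2 d0 d1 d2 : K) : K :=
  c0 ^+ 2 * a0 * b1 * d0 * d1 - 2 * c0 * c1 * a0 * b1 * d0 * d1
  + c1 ^+ 2 * a0 * b1 * d0 * d1 + c0 ^+ 2 * a1 * b1 * d0 * d1
  - 2 * c0 * c1 * a1 * b1 * d0 * d1 + c1 ^+ 2 * a1 * b1 * d0 * d1
  - c0 ^+ 2 * a2 * b1 * d0 * d1 + 2 * c0 * c1 * a2 * b1 * d0 * d1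
  - c1 ^+ 2 * a2 * b1 * d0 * d1 + 2 * c0 * a0 * a2 * b1 * d0 * d1
  - 2 * c1 * a0 * a2 * b1 * d0 * d1 + 2 * c0 * a1 * a2 * b1 * d0 * d1
  - 2 * c1 * a1 * a2 * b1 * d0 * d1 - 2 * c0 * a2 ^+ 2 * b1 * d0 * d1
  + 2 * c1 * a2 ^+ 2 * b1 * d0 * d1 + a0 * a2 ^+ 2 * b1 * d0 * d1
  + a1 * a2 ^+ 2 * b1 * d0 * d1 - a2 ^+ 3 * b1 * d0 * d1
  - c0 ^+ 2 * a0 * b1 * b2 * d2 + 2 * c0 * c1 * a0 * b1 * b2 * d2
  - c1 ^+ 2 * a0 * b1 * b2 * d2 - c0 * a0 ^+ 2 * b1 * b2 * d2
  + c1 * a0 ^+ 2 * b1 * b2 * d2 + c0 ^+ 2 * a1 * b1 * b2 * d2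
  - 2 * c0 * c1 * a1 * b1 * b2 * d2 + c1 ^+ 2 * a1 * b1 * b2 * d2
  + 2 * c0 * a0 * a1 * b1 * b2 * d2 - 2 * c1 * a0 * a1 * b1 * b2 * d2
  - c0 * a1 ^+ 2 * b1 * b2 * d2 + c1 * a1 ^+ 2 * b1 * b2 * d2
  + c0 ^+ 2 * a2 * b1 * b2 * d2 - 2 * c0 * c1 * a2 * b1 * b2 * d2
  + c1 ^+ 2 * a2 * b1 * b2 * d2 - a0 ^+ 2 * a2 * b1 * b2 * d2
  + 2 * a0 * a1 * a2 * b1 * b2 * d2 - a1 ^+ 2 * a2 * b1 * b2 * d2
  + c0 * a2 ^+ 2 * b1 * b2 * d2 - c1 * a2 ^+ 2 * b1 * b2 * d2
  + a0 * a2 ^+ 2 * b1 * b2 * d2 - a1 * a2 ^+ 2 * b1 * b2 * d2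
  - 2 * c0 ^+ 2 * a1 * d0 ^+ 2 * d2 + 4 * c0 * c1 * a1 * d0 ^+ 2 * d2
  - 2 * c1 ^+ 2 * a1 * d0 ^+ 2 * d2 + 2 * a1 * a2 ^+ 2 * d0 ^+ 2 * d2
  - c0 * a0 ^+ 2 * b1 * b2 - c1 * a0 ^+ 2 * b1 * b2
  + 2 * c0 * a0 * a1 * b1 * b2 + 2 * c1 * a0 * a1 * b1 * b2
  - c0 * a1 ^+ 2 * b1 * b2 - c1 * a1 ^+ 2 * b1 * b2
  + 2 * c0 * a0 * a2 * b1 * b2 + 2 * c1 * a0 * a2 * b1 * b2
  + a0 ^+ 2 * a2 * b1 * b2 - 2 * c0 * a1 * a2 * b1 * b2
  - 2 * c1 * a1 * a2 * b1 * b2 - 2 * a0 * a1 * a2 * b1 * b2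
  + a1 ^+ 2 * a2 * b1 * b2 - c0 * a2 ^+ 2 * b1 * b2 - c1 * a2 ^+ 2 * b1 * b2
  - 2 * a0 * a2 ^+ 2 * b1 * b2 + 2 * a1 * a2 ^+ 2 * b1 * b2
  + a2 ^+ 3 * b1 * b2 + 4 * c0 * a1 * a2 * d0 ^+ 2
  + 4 * c1 * a1 * a2 * d0 ^+ 2 - 4 * a1 * a2 ^+ 2 * d0 ^+ 2
  - 4 * c0 * a0 * a2 * d0 * d1 - 4 * c0 * a1 * a2 * d0 * d1
  + 4 * c0 * a2 ^+ 2 * d0 * d1 + 2 * c0 * a0 ^+ 2 * b2 * d2
  - 4 * c0 * a0 * a1 * b2 * d2 + 2 * c0 * a1 ^+ 2 * b2 * d2
  - 2 * c0 * a2 ^+ 2 * b2 * d2.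

Definition X01 {K : comNzRingType}
    (a0 a1 a2 b0 b1 b2 c0 c1 c2 d0 d1 d2 : K) : K :=
  - 4 * c0 * a0 * b0 * b1 * d0 * d1 + 4 * c1 * a0 * b0 * b1 * d0 * d1
  - 4 * c0 * a1 * b0 * b1 * d0 * d1 + 4 * c1 * a1 * b0 * b1 * d0 * d1
  + 4 * c0 * a2 * b0 * b1 * d0 * d1 - 4 * c1 * a2 * b0 * b1 * d0 * d1
  - 4 * a0 * a2 * b0 * b1 * d0 * d1 - 4 * a1 * a2 * b0 * b1 * d0 * d1
  + 4 * a2 ^+ 2 * b0 * b1 * d0 * d1 - 2 * c0 ^+ 2 * b0 * b1 * b2 * d2
  + 4 * c0 * c1 * b0 * b1 * b2 * d2 - 2 * c1 ^+ 2 * b0 * b1 * b2 * d2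
  + 2 * a0 ^+ 2 * b0 * b1 * b2 * d2 - 4 * a0 * a1 * b0 * b1 * b2 * d2
  + 2 * a1 ^+ 2 * b0 * b1 * b2 * d2 - 4 * c0 * a2 * b0 * b1 * b2 * d2
  + 4 * c1 * a2 * b0 * b1 * b2 * d2 - 4 * a0 * a2 * b0 * b1 * b2 * d2
  + 4 * a1 * a2 * b0 * b1 * b2 * d2 + 2 * c0 ^+ 2 * b0 * d0 ^+ 2 * d2
  - 4 * c0 * c1 * b0 * d0 ^+ 2 * d2 + 2 * c1 ^+ 2 * b0 * d0 ^+ 2 * d2
  + 4 * c0 * a1 * b0 * d0 ^+ 2 * d2 - 4 * c1 * a1 * b0 * d0 ^+ 2 * d2
  - 4 * a1 * a2 * b0 * d0 ^+ 2 * d2 - 2 * a2 ^+ 2 * b0 * d0 ^+ 2 * d2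
  + 2 * c0 ^+ 2 * b1 * d1 ^+ 2 * d2 - 4 * c0 * c1 * b1 * d1 ^+ 2 * d2
  + 2 * c1 ^+ 2 * b1 * d1 ^+ 2 * d2 + 4 * c0 * a0 * b1 * d1 ^+ 2 * d2
  - 4 * c1 * a0 * b1 * d1 ^+ 2 * d2 + 4 * a0 * a2 * b1 * d1 ^+ 2 * d2
  - 2 * a2 ^+ 2 * b1 * d1 ^+ 2 * d2 - 4 * c0 ^+ 2 * d0 * d1 * d2 ^+ 2
  + 8 * c0 * c1 * d0 * d1 * d2 ^+ 2 - 4 * c1 ^+ 2 * d0 * d1 * d2 ^+ 2
  + 4 * a0 * a2 * d0 * d1 * d2 ^+ 2 + 4 * a1 * a2 * d0 * d1 * d2 ^+ 2
  + 2 * c0 ^+ 2 * b2 * d2 ^+ 3 - 4 * c0 * c1 * b2 * d2 ^+ 3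
  + 2 * c1 ^+ 2 * b2 * d2 ^+ 3 - 2 * a0 ^+ 2 * b2 * d2 ^+ 3
  + 4 * a0 * a1 * b2 * d2 ^+ 3 - 2 * a1 ^+ 2 * b2 * d2 ^+ 3
  - 4 * c0 * a0 * b0 * b1 * b2 - 4 * c1 * a0 * b0 * b1 * b2
  + 4 * c0 * a1 * b0 * b1 * b2 + 4 * c1 * a1 * b0 * b1 * b2
  + 4 * c0 * a2 * b0 * b1 * b2 + 4 * c1 * a2 * b0 * b1 * b2
  + 4 * a0 * a2 * b0 * b1 * b2 - 4 * a1 * a2 * b0 * b1 * b2
  - 4 * a2 ^+ 2 * b0 * b1 * b2 - 4 * c0 * a1 * b0 * d0 ^+ 2
  - 4 * c1 * a1 * b0 * d0 ^+ 2 - 4 * c0 * a2 * b0 * d0 ^+ 2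
  - 4 * c1 * a2 * b0 * d0 ^+ 2 + 4 * a1 * a2 * b0 * d0 ^+ 2
  + 4 * a2 ^+ 2 * b0 * d0 ^+ 2 + 4 * c0 * a0 * b0 * d0 * d1
  + 4 * c0 * a1 * b0 * d0 * d1 - 4 * c0 * a2 * b0 * d0 * d1
  + 4 * a0 * a2 * b0 * d0 * d1 + 4 * a1 * a2 * b0 * d0 * d1
  - 4 * a2 ^+ 2 * b0 * d0 * d1 - 4 * c1 * a0 * b1 * d0 * d1
  - 4 * c1 * a1 * b1 * d0 * d1 + 4 * c1 * a2 * b1 * d0 * d1
  + 4 * a0 * a2 * b1 * d0 * d1 + 4 * a1 * a2 * b1 * d0 * d1
  - 4 * a2 ^+ 2 * b1 * d0 * d1 + 4 * c0 * a0 * b1 * d1 ^+ 2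
  + 4 * c1 * a0 * b1 * d1 ^+ 2 - 4 * c0 * a2 * b1 * d1 ^+ 2
  - 4 * c1 * a2 * b1 * d1 ^+ 2 - 4 * a0 * a2 * b1 * d1 ^+ 2
  + 4 * a2 ^+ 2 * b1 * d1 ^+ 2 + 4 * c0 * a0 * b0 * b2 * d2
  - 2 * a0 ^+ 2 * b0 * b2 * d2 - 4 * c0 * a1 * b0 * b2 * d2
  + 4 * a0 * a1 * b0 * b2 * d2 - 2 * a1 ^+ 2 * b0 * b2 * d2
  + 4 * c0 * a2 * b0 * b2 * d2 + 2 * a2 ^+ 2 * b0 * b2 * d2
  + 4 * c1 * a0 * b1 * b2 * d2 - 2 * a0 ^+ 2 * b1 * b2 * d2
  - 4 * c1 * a1 * b1 * b2 * d2 + 4 * a0 * a1 * b1 * b2 * d2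
  - 2 * a1 ^+ 2 * b1 * b2 * d2 - 4 * c1 * a2 * b1 * b2 * d2
  + 2 * a2 ^+ 2 * b1 * b2 * d2 + 8 * c1 * a1 * d0 ^+ 2 * d2
  + 8 * c0 * a2 * d0 * d1 * d2 + 8 * c1 * a2 * d0 * d1 * d2
  - 8 * a0 * a2 * d0 * d1 * d2 - 8 * a1 * a2 * d0 * d1 * d2
  - 8 * c0 * a0 * d1 ^+ 2 * d2 + 4 * a0 ^+ 2 * b2 * d2 ^+ 2
  - 8 * a0 * a1 * b2 * d2 ^+ 2 + 4 * a1 ^+ 2 * b2 * d2 ^+ 2
  - 4 * c0 * a2 * b2 * d2 ^+ 2 - 4 * c1 * a2 * b2 * d2 ^+ 2.

Definition X02 {K : comNzRingType}
    (a0 a1 a2 b0 b1 b2 c0 c1 c2 d0 d1 d2 : K) : K :=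
  4 * a0 * b0 ^+ 2 * b1 * d0 * d1 + 4 * a1 * b0 ^+ 2 * b1 * d0 * d1
  - 4 * a2 * b0 ^+ 2 * b1 * d0 * d1 + 4 * c0 * b0 ^+ 2 * b1 * b2 * d2
  - 4 * c1 * b0 ^+ 2 * b1 * b2 * d2 + 4 * a0 * b0 ^+ 2 * b1 * b2 * d2
  - 4 * a1 * b0 ^+ 2 * b1 * b2 * d2 - 4 * c0 * b0 ^+ 2 * d0 ^+ 2 * d2
  + 4 * c1 * b0 ^+ 2 * d0 ^+ 2 * d2 + 4 * a2 * b0 ^+ 2 * d0 ^+ 2 * d2
  - 4 * c0 * b0 * b1 * d1 ^+ 2 * d2 + 4 * c1 * b0 * b1 * d1 ^+ 2 * d2
  - 8 * a0 * b0 * b1 * d1 ^+ 2 * d2 + 4 * a2 * b0 * b1 * d1 ^+ 2 * d2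
  + 8 * c0 * b0 * d0 * d1 * d2 ^+ 2 - 8 * c1 * b0 * d0 * d1 * d2 ^+ 2
  - 4 * a0 * b0 * d0 * d1 * d2 ^+ 2 - 4 * a1 * b0 * d0 * d1 * d2 ^+ 2
  - 4 * a2 * b0 * d0 * d1 * d2 ^+ 2 - 4 * c0 * b0 * b2 * d2 ^+ 3
  + 4 * c1 * b0 * b2 * d2 ^+ 3 - 4 * a0 * b0 * b2 * d2 ^+ 3
  + 4 * a1 * b0 * b2 * d2 ^+ 3 + 8 * a0 * d1 ^+ 2 * d2 ^+ 3
  - 4 * c0 * b0 ^+ 2 * b1 * b2 - 4 * c1 * b0 ^+ 2 * b1 * b2
  + 4 * a2 * b0 ^+ 2 * b1 * b2 + 4 * c0 * b0 ^+ 2 * d0 ^+ 2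
  + 4 * c1 * b0 ^+ 2 * d0 ^+ 2 - 4 * a2 * b0 ^+ 2 * d0 ^+ 2
  - 4 * a0 * b0 ^+ 2 * d0 * d1 - 4 * a1 * b0 ^+ 2 * d0 * d1
  + 4 * a2 * b0 ^+ 2 * d0 * d1 - 4 * a0 * b0 * b1 * d0 * d1
  - 4 * a1 * b0 * b1 * d0 * d1 + 4 * a2 * b0 * b1 * d0 * d1
  + 4 * c0 * b0 * b1 * d1 ^+ 2 + 4 * c1 * b0 * b1 * d1 ^+ 2
  - 4 * a2 * b0 * b1 * d1 ^+ 2 - 4 * a0 * b0 ^+ 2 * b2 * d2
  + 4 * a1 * b0 ^+ 2 * b2 * d2 - 4 * a2 * b0 ^+ 2 * b2 * d2
  + 8 * c1 * b0 * b1 * b2 * d2 - 4 * a0 * b0 * b1 * b2 * d2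
  + 4 * a1 * b0 * b1 * b2 * d2 - 4 * a2 * b0 * b1 * b2 * d2
  - 8 * c1 * b0 * d0 ^+ 2 * d2 - 8 * c0 * b0 * d0 * d1 * d2
  - 8 * c1 * b0 * d0 * d1 * d2 + 8 * a0 * b0 * d0 * d1 * d2
  + 8 * a1 * b0 * d0 * d1 * d2 + 8 * a0 * b0 * d1 ^+ 2 * d2
  - 8 * c1 * b1 * d1 ^+ 2 * d2 + 8 * a0 * b1 * d1 ^+ 2 * d2
  + 4 * c0 * b0 * b2 * d2 ^+ 2 + 4 * c1 * b0 * b2 * d2 ^+ 2
  + 8 * a0 * b0 * b2 * d2 ^+ 2 - 8 * a1 * b0 * b2 * d2 ^+ 2
  + 4 * a2 * b0 * b2 * d2 ^+ 2 + 16 * c1 * d0 * d1 * d2 ^+ 2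
  - 16 * a0 * d1 ^+ 2 * d2 ^+ 2 - 8 * c1 * b2 * d2 ^+ 3.

Definition X30 {K : comNzRingType}
    (a0 a1 a2 b0 b1 b2 c0 c1 c2 d0 d1 d2 : K) : K :=
  c0 ^+ 2 * c1 * b0 * b1 * b2 + c0 * c1 ^+ 2 * b0 * b1 * b2
  - c0 ^+ 2 * c2 * b0 * b1 * b2 + c1 ^+ 2 * c2 * b0 * b1 * b2
  - c0 * c2 ^+ 2 * b0 * b1 * b2 - c1 * c2 ^+ 2 * b0 * b1 * b2
  + c0 ^+ 2 * a1 * b0 * b1 * b2 - c1 ^+ 2 * a1 * b0 * b1 * b2
  + 2 * c0 * c2 * a1 * b0 * b1 * b2 + 2 * c1 * c2 * a1 * b0 * b1 * b2
  - c0 * a1 ^+ 2 * b0 * b1 * b2 - c1 * a1 ^+ 2 * b0 * b1 * b2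
  - c0 ^+ 2 * a2 * b0 * b1 * b2 - 2 * c0 * c1 * a2 * b0 * b1 * b2
  - 2 * c1 * c2 * a2 * b0 * b1 * b2 + c2 ^+ 2 * a2 * b0 * b1 * b2
  + 2 * c1 * a1 * a2 * b0 * b1 * b2 - 2 * c2 * a1 * a2 * b0 * b1 * b2
  + a1 ^+ 2 * a2 * b0 * b1 * b2 + c0 * a2 ^+ 2 * b0 * b1 * b2
  + c2 * a2 ^+ 2 * b0 * b1 * b2 - a1 * a2 ^+ 2 * b0 * b1 * b2
  - c0 ^+ 3 * b0 * b1 * d1 - 2 * c0 ^+ 2 * c1 * b0 * b1 * d1
  - c0 * c1 ^+ 2 * b0 * b1 * d1 + c0 ^+ 2 * c2 * b0 * b1 * d1
  + 2 * c0 * c1 * c2 * b0 * b1 * d1 + c1 ^+ 2 * c2 * b0 * b1 * d1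
  + c0 ^+ 2 * a1 * b0 * b1 * d1 + 2 * c0 * c1 * a1 * b0 * b1 * d1
  + c1 ^+ 2 * a1 * b0 * b1 * d1 + 2 * c0 ^+ 2 * a2 * b0 * b1 * d1
  + 2 * c0 * c1 * a2 * b0 * b1 * d1 - 2 * c0 * c2 * a2 * b0 * b1 * d1
  - 2 * c1 * c2 * a2 * b0 * b1 * d1 - 2 * c0 * a1 * a2 * b0 * b1 * d1
  - 2 * c1 * a1 * a2 * b0 * b1 * d1 - c0 * a2 ^+ 2 * b0 * b1 * d1
  + c2 * a2 ^+ 2 * b0 * b1 * d1 + a1 * a2 ^+ 2 * b0 * b1 * d1
  + 2 * c0 ^+ 2 * c2 * b1 * d1 ^+ 2 - 2 * c1 ^+ 2 * c2 * b1 * d1 ^+ 2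
  + 4 * c1 * c2 * a2 * b1 * d1 ^+ 2 - 2 * c2 * a2 ^+ 2 * b1 * d1 ^+ 2
  + c0 ^+ 3 * b0 * b2 * d2 - c0 ^+ 2 * c1 * b0 * b2 * d2
  + 2 * c0 ^+ 2 * c2 * b0 * b2 * d2 - 2 * c0 * c1 * c2 * b0 * b2 * d2
  + c0 * c2 ^+ 2 * b0 * b2 * d2 - c1 * c2 ^+ 2 * b0 * b2 * d2
  - 2 * c0 ^+ 2 * a1 * b0 * b2 * d2 + 2 * c0 * c1 * a1 * b0 * b2 * d2
  - 2 * c0 * c2 * a1 * b0 * b2 * d2 + 2 * c1 * c2 * a1 * b0 * b2 * d2
  + c0 * a1 ^+ 2 * b0 * b2 * d2 - c1 * a1 ^+ 2 * b0 * b2 * d2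
  - c0 ^+ 2 * a2 * b0 * b2 * d2 - 2 * c0 * c2 * a2 * b0 * b2 * d2
  - c2 ^+ 2 * a2 * b0 * b2 * d2 + 2 * c0 * a1 * a2 * b0 * b2 * d2
  + 2 * c2 * a1 * a2 * b0 * b2 * d2 - a1 ^+ 2 * a2 * b0 * b2 * d2
  - 4 * c0 ^+ 2 * c2 * d1 ^+ 2 * d2 + 4 * c0 * c1 * c2 * d1 ^+ 2 * d2
  + 4 * c0 * c2 * a2 * d1 ^+ 2 * d2 - 2 * c0 ^+ 2 * c1 * b2 * d2 ^+ 2
  + 2 * c1 * c2 ^+ 2 * b2 * d2 ^+ 2 - 4 * c1 * c2 * a1 * b2 * d2 ^+ 2
  + 2 * c1 * a1 ^+ 2 * b2 * d2 ^+ 2 + 4 * c0 ^+ 2 * c1 * d1 * d2 ^+ 2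
  - 4 * c0 * c1 * c2 * d1 * d2 ^+ 2 - 4 * c0 * c1 * a1 * d1 * d2 ^+ 2.

Definition X31 {K : comNzRingType}
    (a0 a1 a2 b0 b1 b2 c0 c1 c2 d0 d1 d2 : K) : K :=
  - 4 * c0 * c1 * b0 * b1 * b2 - 2 * c1 ^+ 2 * b0 * b1 * b2
  + 4 * c0 * c2 * b0 * b1 * b2 + 2 * c2 ^+ 2 * b0 * b1 * b2
  - 4 * c0 * a1 * b0 * b1 * b2 - 4 * c2 * a1 * b0 * b1 * b2
  + 2 * a1 ^+ 2 * b0 * b1 * b2 + 4 * c0 * a2 * b0 * b1 * b2
  + 4 * c1 * a2 * b0 * b1 * b2 - 2 * a2 ^+ 2 * b0 * b1 * b2
  + 4 * c0 ^+ 2 * b0 * b1 * d1 + 4 * c0 * c1 * b0 * b1 * d1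
  - 4 * c0 * c2 * b0 * b1 * d1 - 4 * c1 * c2 * b0 * b1 * d1
  - 4 * c0 * a1 * b0 * b1 * d1 - 4 * c1 * a1 * b0 * b1 * d1
  - 4 * c0 * a2 * b0 * b1 * d1 + 4 * c2 * a2 * b0 * b1 * d1
  + 4 * a1 * a2 * b0 * b1 * d1 - 2 * c0 ^+ 2 * b1 * d1 ^+ 2
  + 2 * c1 ^+ 2 * b1 * d1 ^+ 2 - 4 * c0 * c2 * b1 * d1 ^+ 2
  + 4 * c1 * c2 * b1 * d1 ^+ 2 - 4 * c1 * a2 * b1 * d1 ^+ 2
  - 4 * c2 * a2 * b1 * d1 ^+ 2 + 2 * a2 ^+ 2 * b1 * d1 ^+ 2
  - 4 * c0 ^+ 2 * b0 * b2 * d2 + 4 * c0 * c1 * b0 * b2 * d2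
  - 4 * c0 * c2 * b0 * b2 * d2 + 4 * c1 * c2 * b0 * b2 * d2
  + 4 * c0 * a1 * b0 * b2 * d2 - 4 * c1 * a1 * b0 * b2 * d2
  + 4 * c0 * a2 * b0 * b2 * d2 + 4 * c2 * a2 * b0 * b2 * d2
  - 4 * a1 * a2 * b0 * b2 * d2 + 4 * c0 ^+ 2 * d1 ^+ 2 * d2
  - 4 * c0 * c1 * d1 ^+ 2 * d2 + 4 * c0 * c2 * d1 ^+ 2 * d2
  - 4 * c1 * c2 * d1 ^+ 2 * d2 - 4 * c0 * a2 * d1 ^+ 2 * d2
  - 4 * c2 * a2 * d1 ^+ 2 * d2 + 2 * c0 ^+ 2 * b2 * d2 ^+ 2
  + 4 * c0 * c1 * b2 * d2 ^+ 2 - 4 * c1 * c2 * b2 * d2 ^+ 2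
  - 2 * c2 ^+ 2 * b2 * d2 ^+ 2 + 4 * c1 * a1 * b2 * d2 ^+ 2
  + 4 * c2 * a1 * b2 * d2 ^+ 2 - 2 * a1 ^+ 2 * b2 * d2 ^+ 2
  - 4 * c0 ^+ 2 * d1 * d2 ^+ 2 - 4 * c0 * c1 * d1 * d2 ^+ 2
  + 4 * c0 * c2 * d1 * d2 ^+ 2 + 4 * c1 * c2 * d1 * d2 ^+ 2
  + 4 * c0 * a1 * d1 * d2 ^+ 2 + 4 * c1 * a1 * d1 * d2 ^+ 2
  - 2 * c0 ^+ 2 * b0 * b1 + 2 * c1 ^+ 2 * b0 * b1 + 4 * c0 * a1 * b0 * b1
  + 4 * c1 * a1 * b0 * b1 - 4 * c1 * a2 * b0 * b1 - 4 * a1 * a2 * b0 * b1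
  + 2 * a2 ^+ 2 * b0 * b1 + 2 * c0 ^+ 2 * b0 * b2 - 2 * c2 ^+ 2 * b0 * b2
  + 4 * c2 * a1 * b0 * b2 - 2 * a1 ^+ 2 * b0 * b2 - 4 * c0 * a2 * b0 * b2
  - 4 * c2 * a2 * b0 * b2 + 4 * a1 * a2 * b0 * b2 + 2 * c1 ^+ 2 * b1 * b2
  - 2 * c2 ^+ 2 * b1 * b2 + 4 * c2 * a1 * b1 * b2 - 2 * a1 ^+ 2 * b1 * b2
  - 4 * c1 * a2 * b1 * b2 + 2 * a2 ^+ 2 * b1 * b2 - 4 * c0 ^+ 2 * b0 * d1
  + 4 * c0 * c2 * b0 * d1 + 4 * c0 * a1 * b0 * d1 + 4 * c0 * a2 * b0 * d1
  - 4 * c2 * a2 * b0 * d1 - 4 * a1 * a2 * b0 * d1 - 4 * c1 ^+ 2 * b1 * d1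
  + 4 * c0 * c2 * b1 * d1 + 4 * c0 * a1 * b1 * d1 + 8 * c1 * a2 * b1 * d1
  - 4 * a2 ^+ 2 * b1 * d1 + 8 * c2 * a2 * d1 ^+ 2 + 4 * c0 ^+ 2 * b0 * d2
  - 4 * c0 * c1 * b0 * d2 - 4 * c0 * a1 * b0 * d2 + 4 * c1 * a1 * b0 * d2
  - 4 * c0 * a2 * b0 * d2 + 4 * a1 * a2 * b0 * d2 - 4 * c0 * c1 * b2 * d2
  + 4 * c2 ^+ 2 * b2 * d2 - 8 * c2 * a1 * b2 * d2 + 4 * a1 ^+ 2 * b2 * d2
  - 4 * c0 * a2 * b2 * d2 + 8 * c0 * c1 * d1 * d2 - 8 * c0 * c2 * d1 * d2
  - 8 * c0 * a1 * d1 * d2 + 8 * c0 * a2 * d1 * d2 - 8 * c1 * a1 * d2 ^+ 2.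

Definition X32 {K : comNzRingType}
    (a0 a1 a2 b0 b1 b2 c0 c1 c2 d0 d1 d2 : K) : K :=
  4 * c1 * b0 * b1 * b2 - 4 * c2 * b0 * b1 * b2 + 4 * a1 * b0 * b1 * b2
  - 4 * a2 * b0 * b1 * b2 - 4 * c0 * b0 * b1 * d1 + 4 * c2 * b0 * b1 * d1
  + 4 * a1 * b0 * b1 * d1 + 4 * c0 * b1 * d1 ^+ 2 - 4 * c1 * b1 * d1 ^+ 2
  + 4 * a2 * b1 * d1 ^+ 2 + 4 * c0 * b0 * b2 * d2 - 4 * c1 * b0 * b2 * d2
  - 4 * a2 * b0 * b2 * d2 - 4 * c0 * d1 ^+ 2 * d2 + 4 * c1 * d1 ^+ 2 * d2
  + 4 * a2 * d1 ^+ 2 * d2 - 4 * c0 * b2 * d2 ^+ 2 + 4 * c2 * b2 * d2 ^+ 2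
  - 4 * a1 * b2 * d2 ^+ 2 + 4 * c0 * d1 * d2 ^+ 2 - 4 * c2 * d1 * d2 ^+ 2
  - 4 * a1 * d1 * d2 ^+ 2 + 4 * c0 * b0 * b1 - 4 * c1 * b0 * b1
  - 8 * a1 * b0 * b1 + 4 * a2 * b0 * b1 - 4 * c0 * b0 * b2
  + 4 * c2 * b0 * b2 - 4 * a1 * b0 * b2 + 8 * a2 * b0 * b2
  - 4 * c1 * b1 * b2 + 4 * c2 * b1 * b2 - 4 * a1 * b1 * b2
  + 4 * a2 * b1 * b2 + 4 * c0 * b0 * d1 - 4 * c2 * b0 * d1
  - 4 * a1 * b0 * d1 - 4 * c0 * b1 * d1 + 8 * c1 * b1 * d1
  - 4 * c2 * b1 * d1 - 4 * a1 * b1 * d1 - 8 * a2 * b1 * d1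
  - 8 * a2 * d1 ^+ 2 - 4 * c0 * b0 * d2 + 4 * c1 * b0 * d2
  + 4 * a2 * b0 * d2 + 4 * c0 * b2 * d2 + 4 * c1 * b2 * d2
  - 8 * c2 * b2 * d2 + 8 * a1 * b2 * d2 + 4 * a2 * b2 * d2
  - 8 * c1 * d1 * d2 + 8 * c2 * d1 * d2 + 8 * a1 * d1 * d2
  - 8 * a2 * d1 * d2 + 8 * a1 * d2 ^+ 2 + 8 * a1 * b0 - 8 * a2 * b0
  + 8 * a1 * b1 - 8 * a2 * b2 + 16 * a2 * d1 - 16 * a1 * d2.

(* The two families below are indexed by j; X1 and X2 come from X0 by swapping
   the indices 0 and 1, respectively 0 and 2, of all the variables. *)
Definition X0 {K : comNzRingType} (a b c d : 'I_3 -> K) (j : 'I_3) : K :=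
  let f := match val j with 0%N => X00 | 1%N => X01 | _ => X02 end in
  f (a 0) (a 1) (a 2) (b 0) (b 1) (b 2) (c 0) (c 1) (c 2) (d 0) (d 1) (d 2).

Definition X3 {K : comNzRingType} (a b c d : 'I_3 -> K) (j : 'I_3) : K :=
  let f := match val j with 0%N => X30 | 1%N => X31 | _ => X32 end in
  f (a 0) (a 1) (a 2) (b 0) (b 1) (b 2) (c 0) (c 1) (c 2) (d 0) (d 1) (d 2).

Definition Xcoef {K : comNzRingType} (a b c d : 'I_3 -> K)
    (i : 'I_4) (j : 'I_3) : K :=
  let X0_swap (s : {perm 'I_3}) := X0 (a \o s) (b \o s) (c \o s) (d \o s) j in
  match val i with
  | 0%N => X0 a b c d j
  | 1%N => X0_swap (tperm 0 1)
  | 2%N => X0_swap (tperm 0 2)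
  | _ => X3 a b c d j
  end.

Section FourPointAlgorithm.
Context {R : realType}.
Implicit Types (P p : 'I_4 -> 'rV[R]_3).

Definition emb (i : 'I_3) : 'I_4 := widen_ord (leqnSn 3) i.

(* Arithmetic in 'I_3 is modulo 3, so j = i + 1 and k = i + 2. *)
Definition coef_a P (i : 'I_3) : R :=
  norm2 (P (emb (i + 1)) - P (emb (i + 2))) ^+ 2.

Definition coef_c P (i : 'I_3) : R :=
  norm2 (P (emb i) - P ord_max) ^+ 2.

Definition coef_b p (i : 'I_3) : R :=
  let p3 := p ord_max in
  dot (p (emb i)) (p (emb i)) * dot p3 p3 / dot (p (emb i)) p3 ^+ 2.

Definition coef_d p (i : 'I_3) : R :=
  let p3 := p ord_max in
  let pj := p (emb (i + 1)) in
  let pk := p (emb (i + 2)) in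
  dot pj pk * dot p3 p3 / (dot pj p3 * dot pk p3).

Definition X P p : 'I_4 -> 'I_3 -> R :=
  Xcoef (coef_a P) (coef_b p) (coef_c P) (coef_d p).

Definition Q P p (i : 'I_4) : {poly R} :=
  X P p i 2 *: 'X^2 + X P p i 1 *: 'X + (X P p i 0)%:P.

(* [q] has degree exactly 2, with complex roots [r false] and [r true], listed
   with multiplicity. *)
Definition root_pair (q : {poly R}) (r : bool -> R[i]) : Prop :=
  size q = 3%N /\
  map_poly (real_complex R) q =
    (lead_coef q)%:C *: (('X - (r false)%:P) * ('X - (r true)%:P)).

(* In R[i], [0 <= x] means that x is real and nonnegative: in that case the
   root is the nonnegative one, otherwise either complex root is allowed. *)
Definition is_sqrt (x w : R[i]) : Prop :=
  w ^+ 2 = x /\ (0 <= x -> 0 <= w).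

Definition sqrt_sign p (i : 'I_4) : R :=
  if i == ord_max then 1 else Num.sg (dot (p i) (p ord_max)).

Definition discrepancies P p (z : 'I_4 -> R[i]) : 'rV[R[i]]_(3 + 3) :=
  let z3 := z ord_max in
  row_mx
    (\row_(i < 3)
       let zj := z (emb (i + 1)) in
       let zk := z (emb (i + 2)) in
       ((coef_a P i)%:C
        - ((coef_b p (i + 1))%:C * zj ^+ 2 + (coef_b p (i + 2))%:C * zk ^+ 2
           - 2 * (coef_d p i)%:C * zj * zk)))
    (\row_(i < 3)
       let zi := z (emb i) in
       ((coef_c P i)%:C
        - (z3 ^+ 2 + (coef_b p i)%:C * zi ^+ 2 - 2 * zi * z3))).

(* [four_point_output err P p zorig]: some run of the algorithm, with error
   function [err], outputs [zorig]. A run is determined by the order in which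
   the roots [r] are listed, by the choices of square roots giving, for each of
   the 16 selections [t] of one root of each Q_i, the quadruple [z t], and by
   the selected minimizer [s]. There is no run unless every Q_i is quadratic. *)
Definition four_point_output (err : 'rV[R[i]]_(3 + 3) -> R) P p
    (zorig : 'I_4 -> R[i]) : Prop :=
  exists (r : 'I_4 -> bool -> R[i])
         (z : {ffun 'I_4 -> bool} -> 'I_4 -> R[i])
         (s : {ffun 'I_4 -> bool}),
  [/\ forall i, root_pair (Q P p i) (r i),
      forall (t : {ffun 'I_4 -> bool}) i, exists2 w, is_sqrt (r i (t i)) w
                           & z t i = (sqrt_sign p i)%:C * w,
      forall t : {ffun 'I_4 -> bool},
        err (discrepancies P p (z s)) <= err (discrepancies P p (z t))
    & forall i, zorig i =
        (norm2 (p ord_max) / dot (p i) (p ord_max))%:C * z s i].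

End FourPointAlgorithm.

(* Main.v *)
Require Import Defs.
From mathcomp Require Import all_boot all_order all_algebra all_fingroup.
From mathcomp Require Import reals complex mpoly ring.

(* Put [q_i = T(P_i)] and [z_i = (q_i . q_3) / |q_3|]. These numbers solve the
   six equations, and substituting the equations into the [X_(i,j)] shows that
   [z_i^2] is a root of [Q_i]. Hence one of the 16 quadruples has error zero, so
   the selected quadruple [z'] also solves the six equations. Each [z'_i^2] is
   [z_i^2] or the other root of [Q_i], which is a rational function of the
   [q_i]. The equation for [c_i], squared, is a relation between [z'_i^2] and
   [z'_3^2] alone. For general [q], the relation for [c_0] fails when
   [z'_3^2] is the wrong root, and when it is not, the one for [c_i] fails if
   [z'_i^2] is the wrong root. The signs are prescribed by the algorithm.
   Genericity is the nonvanishing of finitely many rational functions of [q],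
   which is checked at one integral configuration. *)

Set Implicit Arguments.
Unset Strict Implicit.
Unset Printing Implicit Defensive.

Import Order.TTheory GRing.Theory Num.Theory.
Local Open Scope ring_scope.
Local Open Scope complex_scope.

(** * The six equations and the quadratics that they imply *)

Section SixEquations.
Context {K : comNzRingType}.

Definition six_equations (a b c d : 'I_3 -> K) (z : 'I_4 -> K) : Prop :=
  (forall i, a i = b (i + 1) * z (emb (i + 1)) ^+ 2
                   + b (i + 2) * z (emb (i + 2)) ^+ 2
                   - 2 * d i * z (emb (i + 1)) * z (emb (i + 2))) /\
  (forall i, c i = z ord_max ^+ 2 + b i * z (emb i) ^+ 2
                   - 2 * z (emb i) * z ord_max).

(** Once [a0], [a1], [a2], [c0] and [c1] are substituted, what remains is a polynomial in the [b],
    [d] and [z] variables that is identically zero. *)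
Lemma X0_quadratic (a0 a1 a2 b0 b1 b2 c0 c1 c2 d0 d1 d2 z0 z1 z2 z3 : K) :
  a0 = b1 * z1 ^+ 2 + b2 * z2 ^+ 2 - 2 * d0 * z1 * z2 ->
  a1 = b2 * z2 ^+ 2 + b0 * z0 ^+ 2 - 2 * d1 * z2 * z0 ->
  a2 = b0 * z0 ^+ 2 + b1 * z1 ^+ 2 - 2 * d2 * z0 * z1 ->
  c0 = z3 ^+ 2 + b0 * z0 ^+ 2 - 2 * z0 * z3 ->
  c1 = z3 ^+ 2 + b1 * z1 ^+ 2 - 2 * z1 * z3 ->
  X02 a0 a1 a2 b0 b1 b2 c0 c1 c2 d0 d1 d2 * (z0 ^+ 2) ^+ 2
  + X01 a0 a1 a2 b0 b1 b2 c0 c1 c2 d0 d1 d2 * z0 ^+ 2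
  + X00 a0 a1 a2 b0 b1 b2 c0 c1 c2 d0 d1 d2 = 0.
Proof. by rewrite /X00 /X01 /X02 => -> -> -> -> ->; ring. Qed.

Lemma X3_quadratic (a0 a1 a2 b0 b1 b2 c0 c1 c2 d0 d1 d2 z0 z1 z2 z3 : K) :
  a1 = b2 * z2 ^+ 2 + b0 * z0 ^+ 2 - 2 * d1 * z2 * z0 ->
  a2 = b0 * z0 ^+ 2 + b1 * z1 ^+ 2 - 2 * d2 * z0 * z1 ->
  c0 = z3 ^+ 2 + b0 * z0 ^+ 2 - 2 * z0 * z3 ->
  c1 = z3 ^+ 2 + b1 * z1 ^+ 2 - 2 * z1 * z3 ->
  c2 = z3 ^+ 2 + b2 * z2 ^+ 2 - 2 * z2 * z3 ->
  X32 a0 a1 a2 b0 b1 b2 c0 c1 c2 d0 d1 d2 * (z3 ^+ 2) ^+ 2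
  + X31 a0 a1 a2 b0 b1 b2 c0 c1 c2 d0 d1 d2 * z3 ^+ 2
  + X30 a0 a1 a2 b0 b1 b2 c0 c1 c2 d0 d1 d2 = 0.
Proof. by rewrite /X30 /X31 /X32 => -> -> -> -> ->; ring. Qed.

Lemma ord3_cases (A : 'I_3 -> Prop) : A 0 -> A 1 -> A 2 -> forall i, A i.
Proof.
move=> A0 A1 A2 [[|[|[|//]]] i3].
- by rewrite (_ : Ordinal i3 = 0) //; apply: val_inj.
- by rewrite (_ : Ordinal i3 = 1) //; apply: val_inj.
- by rewrite (_ : Ordinal i3 = 2) //; apply: val_inj.
Qed.

Lemma ord4_cases (A : 'I_4 -> Prop) :
  (forall i, A (emb i)) -> A ord_max -> forall i, A i.
Proof.
move=> Aemb Amax i; have [i3|i3] := ltnP i 3.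
  by rewrite (_ : i = emb (Ordinal i3)) //; apply: val_inj.
rewrite (_ : i = ord_max) //; apply/val_inj/eqP.
by rewrite eqn_leq i3 -ltnS ltn_ord.
Qed.

Lemma ord3_add : (((0 + 1 = 1 :> 'I_3)%R * (0 + 2 = 2 :> 'I_3)%R) *
  ((1 + 1 = 2 :> 'I_3)%R * (1 + 2 = 0 :> 'I_3)%R) *
  ((2 + 1 = 0 :> 'I_3)%R * (2 + 2 = 1 :> 'I_3)%R))%type.
Proof. by do !split; apply: val_inj. Qed.

Lemma tperm01_ord3 : ((tperm 0 1 0 = 1 :> 'I_3)%R *
  (tperm 0 1 1 = 0 :> 'I_3)%R * (tperm 0 1 2 = 2 :> 'I_3)%R)%type.
Proof. by do !split; rewrite ?tpermL ?tpermR ?tpermD. Qed.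

Lemma tperm02_ord3 : ((tperm 0 2 0 = 2 :> 'I_3)%R *
  (tperm 0 2 1 = 1 :> 'I_3)%R * (tperm 0 2 2 = 0 :> 'I_3)%R)%type.
Proof. by do !split; rewrite ?tpermL ?tpermR ?tpermD. Qed.

Lemma Xcoef_quadratic (a b c d : 'I_3 -> K) (z : 'I_4 -> K) :
  six_equations a b c d z ->
  forall i, Xcoef a b c d i 2 * (z i ^+ 2) ^+ 2
            + Xcoef a b c d i 1 * z i ^+ 2 + Xcoef a b c d i 0 = 0.
Proof.
case=> ha hc.
have [[a0 a1] a2] := (ha 0, ha 1, ha 2).
have [[c0 c1] c2] := (hc 0, hc 1, hc 2).
rewrite !ord3_add in a0 a1 a2.
move=> i; elim/ord4_cases: i => [i|]; last first.
  by rewrite /Xcoef /X3 /=; apply: (X3_quadratic (a 0) (d 0) a1 a2 c0 c1 c2).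
elim/ord3_cases: i.
- rewrite /Xcoef /X0 /=.
  by apply: (X0_quadratic (c 2) a0 a1 a2 c0 c1).
(* The equation for [a_i] is symmetric in the two other indices, so a transposition permutes the six
   equations; [ring] only restores the order of the terms. *)
- rewrite /Xcoef /X0 /= !tperm01_ord3.
  apply: (@X0_quadratic _ _ _ _ _ _ _ _ _ _ _ _ _ (z (emb 0)) (z (emb 2))
    (z ord_max) _ _ _ c1 c0);
    rewrite ?a0 ?a1 ?a2; ring.
- rewrite /Xcoef /X0 /= !tperm02_ord3.
  apply: (@X0_quadratic _ _ _ _ _ _ _ _ _ _ _ _ _ (z (emb 1)) (z (emb 0))
    (z ord_max) _ _ _ c2 c1);
    rewrite ?a0 ?a1 ?a2; ring.
Qed.

End SixEquations.

(** * Telling the true squares from the other roots *)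

Section Separation.
Context {R : realType}.
Variables (a b c d : 'I_3 -> R).

(* By Vieta's formulas, the second root of [Q_i] when [x] is the first one. *)
Definition other_root (i : 'I_4) (x : R) : R :=
  - (Xcoef a b c d i 1 / Xcoef a b c d i 2) - x.

(* Eliminating the sign from [c_i = z_3^2 + b_i z_i^2 - 2 z_i z_3] gives
   [c_residual i (z_i^2) (z_3^2) = 0]. *)
Definition c_residual (i : 'I_3) (x y : R) : R :=
  4 * x * y - (y + b i * x - c i) ^+ 2.

(** Here [w i] stands for the true square [z_i^2]. The first condition makes each [Q_i] quadratic,
    the second rejects a wrong [z_i^2] once [z_3^2] is right, and the last two reject a wrong
    [z_3^2] for either candidate value of [z_0^2]. *)
Definition separated (w : 'I_4 -> R) : Prop :=
  [/\ forall i, Xcoef a b c d i 2 != 0,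
      forall i, c_residual i (other_root (emb i) (w (emb i))) (w ord_max) != 0,
      c_residual 0 (w (emb 0)) (other_root ord_max (w ord_max)) != 0
    & c_residual 0 (other_root (emb 0) (w (emb 0)))
                   (other_root ord_max (w ord_max)) != 0].

(** The equation gives [2 u v = v^2 + b u^2 - c], whose square involves [u] and [v] only through
    [u^2] and [v^2]. These are real even if [u] and [v] are not, so the relation descends from
    [R[i]] to [R]. *)
Lemma c_residual_eq0 i (x y : R) (u v : R[i]) :
  u ^+ 2 = x%:C -> v ^+ 2 = y%:C ->
  (c i)%:C = v ^+ 2 + (b i)%:C * u ^+ 2 - 2 * u * v ->
  c_residual i x y = 0.
Proof.
move=> ux vy hc; apply: (@fmorph_inj _ _ (real_complex R)).
rewrite /c_residual !(rmorph0, rmorphB, rmorphD, rmorphM, rmorphXn, rmorph_nat).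
by rewrite /= hc -ux -vy; ring.
Qed.

Lemma separated_squares (w : 'I_4 -> R) (z : 'I_4 -> R[i]) :
  separated w ->
  (forall i, z i ^+ 2 = (w i)%:C \/ z i ^+ 2 = (other_root i (w i))%:C) ->
  (forall i, (c i)%:C = z ord_max ^+ 2 + (b i)%:C * z (emb i) ^+ 2
                        - 2 * z (emb i) * z ord_max) ->
  forall i, z i ^+ 2 = (w i)%:C.
Proof.
case=> _ sep_i sep_03 sep_03' zw hc.
have z3 : z ord_max ^+ 2 = (w ord_max)%:C.
  have [//|z3] := zw ord_max.
  have [z0|z0] := zw (emb 0); have := c_residual_eq0 z0 z3 (hc 0) => /eqP.
  - by rewrite (negbTE sep_03).
  - by rewrite (negbTE sep_03').
move=> i; elim/ord4_cases: i => // i.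
have [//|zi] := zw (emb i).
by have /eqP := c_residual_eq0 zi z3 (hc i); rewrite (negbTE (sep_i i)).
Qed.

End Separation.

Lemma is_sqrt_real (R : realType) (x : R) (w : R[i]) :
  is_sqrt (x ^+ 2)%:C w -> w = `|x|%:C.
Proof.
case=> w2 /(_ _); rewrite lecR sqr_ge0 => /(_ isT) w_ge0.
apply/eqP; rewrite -(@eqrXn2 _ 2) //; last by rewrite lecR.
by rewrite w2 -rmorphXn /= real_normK ?num_real.
Qed.

Lemma is_sqrt_exists (R : realType) (x : R[i]) : exists w, is_sqrt x w.
Proof. by exists (sqrtC x); split; [exact: sqrtCK | rewrite sqrtC_ge0]. Qed.

(** Serves to compare the listing of roots chosen by a run with the explicit one given by Vieta's
    formulas. *)
Lemma root_root_pair (R : realType) (q : {poly R}) (r : bool -> R[i]) x :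
  root_pair q r ->
  root (map_poly (real_complex R) q) x = (x == r false) || (x == r true).
Proof.
case=> sz ->; have lc : (lead_coef q)%:C != 0.
  by rewrite fmorph_eq0 lead_coef_eq0 -size_poly_eq0 sz.
by rewrite rootZ // rootM !root_XsubC.
Qed.

(** * Correctness of the algorithm on separated data *)

Section Correctness.
Context {R : realType}.
Variables (P p : 'I_4 -> 'rV[R]_3) (z : 'I_4 -> R).
Let a := coef_a P.
Let b := coef_b p.
Let c := coef_c P.
Let d := coef_d p.
Hypothesis z_eqs : six_equations a b c d z.
Hypothesis z_sep : separated a b c d (fun i => z i ^+ 2).
Hypothesis z_sign : forall i, sqrt_sign p i = Num.sg (z i).
Hypothesis z_neq0 : forall i, z i != 0.

Lemma Q_root_pair i :
  root_pair (Q P p i)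
    (fun t => (if t then other_root a b c d i (z i ^+ 2) else z i ^+ 2)%:C).
Proof.
have X2 : X P p i 2 != 0 by case: z_sep => + _ _ _; apply.
have size_lin : (size (X P p i 1 *: 'X + (X P p i 0)%:P)%R < 3)%N.
  apply: leq_ltn_trans (size_polyD _ _) _; rewrite gtn_max.
  rewrite (leq_ltn_trans (size_scale_leq _ _)) ?size_polyX //.
  by rewrite (leq_ltn_trans (size_polyC_leq1 _)).
have sizeX2 : size (X P p i 2 *: 'X^2) = 3 by rewrite size_scale ?size_polyXn.
have QE : Q P p i = X P p i 2 *: 'X^2 + (X P p i 1 *: 'X + (X P p i 0)%:P).
  by rewrite addrA.
split; first by rewrite QE size_polyDl sizeX2.
rewrite QE lead_coefDl ?sizeX2 // lead_coefZ lead_coefXn mulr1 -QE.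
set al := z i ^+ 2; set be := other_root a b c d i al.
have QF : Q P p i = X P p i 2 *: (('X - al%:P) * ('X - be%:P)).
  (* The sum of the roots is built into [other_root]; their product then follows from [z_i^2] being
     a root. *)
  have e1 : X P p i 1 = - X P p i 2 * (al + be).
    by rewrite /be /other_root -/(X P p); field.
  have e0 : X P p i 0 = X P p i 2 * (al * be).
    have := Xcoef_quadratic z_eqs i; rewrite -/(X P p) -/al.
    move/eqP; rewrite addrC addr_eq0 => /eqP ->; rewrite e1; ring.
  rewrite /Q e1 e0 -!mul_polyC !(polyCM, polyCN, polyCD); ring.
by rewrite {1}QF map_polyZ rmorphM /= !rmorphB /= !map_polyX !map_polyC.
Qed.

Lemma discrepancies_eq0 (y : 'I_4 -> R[i]) :
  discrepancies P p y = 0 <->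
  six_equations (fun i => (a i)%:C) (fun i => (b i)%:C) (fun i => (c i)%:C)
    (fun i => (d i)%:C) y.
Proof.
split=> [/eqP|[ha hc]]; last first.
  rewrite /discrepancies -row_mx0; congr row_mx; apply/rowP => i; rewrite !mxE.
    by rewrite -/a -/b -/d ha subrr.
  by rewrite -/b -/c hc subrr.
rewrite /discrepancies row_mx_eq0 => /andP[/eqP/rowP ha /eqP/rowP hc].
by split=> i; apply/eqP; rewrite -subr_eq0; apply/eqP;
  [have := ha i | have := hc i]; rewrite !mxE.
Qed.

Lemma six_equationsC :
  six_equations (fun i => (a i)%:C) (fun i => (b i)%:C) (fun i => (c i)%:C)
    (fun i => (d i)%:C) (fun i => (z i)%:C).
Proof.
by case: z_eqs => ha hc; split=> i;
  rewrite ?ha ?hc !(rmorphB, rmorphD, rmorphM, rmorphXn, rmorph_nat).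
Qed.

Lemma signed_sqrt i (w : R[i]) :
  is_sqrt (z i ^+ 2)%:C w -> (sqrt_sign p i)%:C * w = (z i)%:C.
Proof. by move/is_sqrt_real => ->; rewrite z_sign -rmorphM -numEsg. Qed.

Variable err : 'rV[R[i]]_(3 + 3) -> R.
Hypothesis err_ge0 : forall e, 0 <= err e.
Hypothesis err_eq0 : forall e, err e = 0 <-> e = 0.

(** The true square is listed first for each [i], so the selection that is constantly [false] has
    error zero, the least possible value. *)
Lemma four_point_output_exists : exists y, four_point_output err P p y.
Proof.
pose r i (t : bool) : R[i] :=
  (if t then other_root a b c d i (z i ^+ 2) else z i ^+ 2)%:C.
have /fin_all_exists[w hw] (it : 'I_4 * bool) := is_sqrt_exists (r it.1 it.2).
pose y (t : {ffun 'I_4 -> bool}) i := (sqrt_sign p i)%:C * w (i, t i).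
pose s : {ffun 'I_4 -> bool} := [ffun=> false].
exists (fun i => (norm2 (p ord_max) / dot (p i) (p ord_max))%:C * y s i).
exists r, y, s; split=> //; first exact: Q_root_pair.
- by move=> t i; exists (w (i, t i)); first exact: hw (i, t i).
move=> t; suff -> : discrepancies P p (y s) = 0.
  by rewrite (err_eq0 0).2.
apply/discrepancies_eq0.
have ys i : y s i = (z i)%:C.
  by rewrite /y signed_sqrt //; have := hw (i, s i); rewrite ffunE.
by case: six_equationsC => ha hc; split=> i; rewrite !ys.
Qed.

Lemma four_point_output_unique y : four_point_output err P p y ->
  forall i, y i = (norm2 (p ord_max) / dot (p i) (p ord_max) * z i)%:C.
Proof.
case=> r [x [s [hr hx hmin hy]]].
have r_roots i t : r i t = (z i ^+ 2)%:C \/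
                   r i t = (other_root a b c d i (z i ^+ 2))%:C.
  have : root (map_poly (real_complex R) (Q P p i)) (r i t).
    by rewrite (root_root_pair _ (hr i)); case: t; rewrite eqxx ?orbT.
  rewrite (root_root_pair _ (Q_root_pair i)) /=.
  by case/orP=> /eqP ->; [left | right].
have r_true i : exists t, r i t = (z i ^+ 2)%:C.
  have : root (map_poly (real_complex R) (Q P p i)) (z i ^+ 2)%:C.
    by rewrite (root_root_pair _ (Q_root_pair i)) /= eqxx.
  rewrite (root_root_pair _ (hr i)).
  by case/orP=> /eqP ->; [exists false | exists true].
(* The order of the roots in the run is unknown, so the selection [t] of the true squares is made
   index by index. Its error is zero, hence so is that of the minimizer [s]. *)
have /fin_all_exists[f hf] := r_true.
pose t : {ffun 'I_4 -> bool} := finfun f.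
have xt i : x t i = (z i)%:C.
  have [w] := hx t i; rewrite ffunE hf => hw ->; exact: signed_sqrt.
have errt : err (discrepancies P p (x t)) = 0.
  apply/err_eq0/discrepancies_eq0.
  by case: six_equationsC => ha hc; split=> i; rewrite !xt.
have /err_eq0/discrepancies_eq0[_ hc] : err (discrepancies P p (x s)) = 0.
  by apply/le_anti; rewrite err_ge0 -errt hmin.
(* As [z i] is nonzero, the prescribed sign is [1] or [-1], so it disappears on squaring. *)
have sgn2 i : (sqrt_sign p i) ^+ 2 = 1 by rewrite z_sign sqr_sg z_neq0.
have xr i : x s i ^+ 2 = r i (s i).
  have [w [w2 _] ->] := hx s i.
  by rewrite exprMn -rmorphXn sgn2 w2 rmorph1 mul1r.
have xz i : x s i = (z i)%:C.
  (* The squares are now known to be the true ones, and the sign rule recovers the numbers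
     themselves. *)
  have := separated_squares z_sep _ hc => /(_ _ i) e.
  have [w hw ->] := hx s i; apply: signed_sqrt.
  rewrite -e -?xr // in hw *.
  by move=> k; rewrite xr.
by move=> i; rewrite hy xz -rmorphM.
Qed.

End Correctness.

(** * Generic conditions, and rational functions regular at a base point *)

Section Genericity.
Context {R : fieldType} {n : nat} {U : Type} (ev : U -> 'I_n -> R) (q0 : U).

(** Nonvanishing at one common point [q0] is preserved by products, so generic conditions can be
    combined, and each can be verified by an evaluation at [q0]. *)
Definition generic_at (A : U -> Prop) : Prop :=
  exists2 F : {mpoly R[n]}, F.@[ev q0] != 0
                         & forall q, F.@[ev q] != 0 -> A q.

(* [f] is the restriction of a rational function whose denominator does not
   vanish at [q0]. *)
Definition regular_at (f : U -> R) : Prop :=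
  exists N D : {mpoly R[n]}, D.@[ev q0] != 0 /\
    forall q, D.@[ev q] != 0 -> f q = N.@[ev q] / D.@[ev q].

Lemma generic_sub (A B : U -> Prop) :
  (forall q, A q -> B q) -> generic_at A -> generic_at B.
Proof. by move=> AB [F F0 FA]; exists F => // q /FA/AB. Qed.

Lemma generic_and (A B : U -> Prop) :
  generic_at A -> generic_at B -> generic_at (fun q => A q /\ B q).
Proof.
move=> [F F0 FA] [G G0 GB]; exists (F * G) => [|q].
  by rewrite mevalM mulf_neq0.
by rewrite mevalM mulf_eq0 negb_or => /andP[/FA ? /GB].
Qed.

Lemma generic_forall (I : finType) (A : I -> U -> Prop) :
  (forall i, generic_at (A i)) -> generic_at (fun q => forall i, A i q).
Proof.
move=> hA; suff: generic_at (fun q => forall i, i \in enum I -> A i q).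
  by apply: generic_sub => q Aq i; apply: Aq; rewrite mem_enum.
elim: (enum I) => [|i s IHs]; first by exists 1 => //; rewrite meval1 oner_neq0.
apply: generic_sub (generic_and (hA i) IHs) => q [Ai As] j.
by rewrite inE => /orP[/eqP -> //|/As].
Qed.

Lemma generic_neq0 f :
  regular_at f -> f q0 != 0 -> generic_at (fun q => f q != 0).
Proof.
(* The factor [D] keeps the formula for [f] valid wherever the product is nonzero. *)
case=> N [D [D0 fE]] f0; exists (N * D) => [|q].
  rewrite mevalM mulf_neq0 //; apply: contraNneq f0.
  by rewrite fE // => ->; rewrite mul0r.
rewrite mevalM mulf_eq0 negb_or => /andP[Nq Dq].
by rewrite fE // mulf_neq0 ?invr_neq0.
Qed.

Lemma regular_ext f g : f =1 g -> regular_at f -> regular_at g.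
Proof.
by move=> fg [N [D [D0 fE]]]; exists N, D; split=> // q /fE; rewrite fg.
Qed.

Lemma regular_var k : regular_at (fun q => ev q k).
Proof.
exists 'X_k, 1; rewrite meval1 oner_neq0; split=> // q _.
by rewrite mevalXU meval1 divr1.
Qed.

Lemma regular_const x : regular_at (fun=> x).
Proof.
exists x%:MP, 1; rewrite meval1 oner_neq0; split=> // q _.
by rewrite mevalC meval1 divr1.
Qed.

Lemma regularD f g :
  regular_at f -> regular_at g -> regular_at (fun q => f q + g q).
Proof.
move=> [N [D [D0 fE]]] [N' [D' [D'0 gE]]]; exists (N * D' + N' * D), (D * D').
rewrite mevalM mulf_neq0 //; split=> // q.
rewrite mevalM mulf_eq0 negb_or => /andP[Dq D'q].
by rewrite fE // gE // mevalD !mevalM addf_div.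
Qed.

Lemma regularN f : regular_at f -> regular_at (fun q => - f q).
Proof.
move=> [N [D [D0 fE]]]; exists (- N), D; split=> // q Dq.
by rewrite fE // mevalN mulNr.
Qed.

Lemma regularM f g :
  regular_at f -> regular_at g -> regular_at (fun q => f q * g q).
Proof.
move=> [N [D [D0 fE]]] [N' [D' [D'0 gE]]]; exists (N * N'), (D * D').
rewrite mevalM mulf_neq0 //; split=> // q.
rewrite mevalM mulf_eq0 negb_or => /andP[Dq D'q].
by rewrite fE // gE // mevalM mulf_div.
Qed.

Lemma regularX f k : regular_at f -> regular_at (fun q => f q ^+ k).
Proof.
move=> hf; elim: k => [|k IHk]; first exact: regular_const.
by apply: regular_ext (regularM hf IHk) => q; rewrite exprS.
Qed.

Lemma regularV f : regular_at f -> f q0 != 0 -> regular_at (fun q => (f q)^-1).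
Proof.
(* The inverse is written [D^2 / (N D)] instead of [D / N], so that a nonzero denominator also
   guarantees that [f] equals [N / D]. *)
move=> [N [D [D0 fE]]] f0; exists (D * D), (N * D).
have N0 : N.@[ev q0] != 0.
  by apply: contraNneq f0; rewrite fE // => ->; rewrite mul0r.
rewrite mevalM mulf_neq0 //; split=> // q.
rewrite !mevalM mulf_eq0 negb_or => /andP[Nq Dq].
by rewrite fE // invf_div -mulf_div divff // mulr1.
Qed.

End Genericity.

(** Recursion on the syntax of a polynomial expression. Inverses are treated separately, since they
    require a nonzero value at [q0]. *)
Ltac regular :=
  lazymatch goal with
  | |- regular_at _ _ (fun _ => ?x) => exact: regular_const
  | |- regular_at _ _ (fun _ => _ + _) => apply: regularD; regular
  | |- regular_at _ _ (fun _ => - _) => apply: regularN; regular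
  | |- regular_at _ _ (fun _ => _ * _) => apply: regularM; regular
  | |- regular_at _ _ (fun _ => _ ^+ _) => apply: regularX; regular
  | |- _ => trivial
  end.

(** * Regularity of the coefficients [X_(i,j)] *)

Section RegularCoefficients.
Context {R : fieldType} {n : nat} {U : Type} (ev : U -> 'I_n -> R) (q0 : U).
Implicit Types a b c d : 'I_3 -> U -> R.

Lemma regular_X0 a b c d j :
  (forall i, regular_at ev q0 (a i)) -> (forall i, regular_at ev q0 (b i)) ->
  (forall i, regular_at ev q0 (c i)) -> (forall i, regular_at ev q0 (d i)) ->
  regular_at ev q0 (fun q => X0 (a^~ q) (b^~ q) (c^~ q) (d^~ q) j).
Proof.
move=> ha hb hc hd; rewrite /X0.
by case: (val j) => [|[|k]]; rewrite /X00 /X01 /X02; regular.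
Qed.

Lemma regular_X3 a b c d j :
  (forall i, regular_at ev q0 (a i)) -> (forall i, regular_at ev q0 (b i)) ->
  (forall i, regular_at ev q0 (c i)) -> (forall i, regular_at ev q0 (d i)) ->
  regular_at ev q0 (fun q => X3 (a^~ q) (b^~ q) (c^~ q) (d^~ q) j).
Proof.
move=> ha hb hc hd; rewrite /X3.
by case: (val j) => [|[|k]]; rewrite /X30 /X31 /X32; regular.
Qed.

Lemma regular_Xcoef a b c d i j :
  (forall i, regular_at ev q0 (a i)) -> (forall i, regular_at ev q0 (b i)) ->
  (forall i, regular_at ev q0 (c i)) -> (forall i, regular_at ev q0 (d i)) ->
  regular_at ev q0 (fun q => Xcoef (a^~ q) (b^~ q) (c^~ q) (d^~ q) i j).
Proof.
move=> ha hb hc hd; have hX0 (s : 'I_3 -> 'I_3) : regular_at ev q0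
    (fun q => X0 (a^~ q \o s) (b^~ q \o s) (c^~ q \o s) (d^~ q \o s) j).
  apply: (@regular_X0 (a \o s) (b \o s) (c \o s) (d \o s)) => k /=;
    [exact: ha | exact: hb | exact: hc | exact: hd].
rewrite /Xcoef; case: (val i) => [|[|[|k]]]; last exact: regular_X3.
- exact: regular_X0.
- exact: hX0.
- exact: hX0.
Qed.

End RegularCoefficients.

(** * Depths of four points seen from the origin *)

Section Configurations.
Context {R : realType}.
Implicit Types (u v : 'rV[R]_3) (q : 'I_4 -> 'rV[R]_3).

Lemma dotE u v : dot u v = u 0 0 * v 0 0 + u 0 1 * v 0 1 + u 0 2 * v 0 2.
Proof.
rewrite /dot !big_ord_recr big_ord0 /= add0r.
by congr (_ * _ + _ * _ + _ * _); congr (_ _ _); apply: val_inj.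
Qed.

Lemma dotZ x y u v : dot (x *: u) (y *: v) = x * y * dot u v.
Proof. by rewrite !dotE !mxE; ring. Qed.

Lemma dot_ge0 u : 0 <= dot u u.
Proof. by apply: sumr_ge0 => k _; rewrite -expr2 sqr_ge0. Qed.

Lemma norm2_sqr u : norm2 u ^+ 2 = dot u u.
Proof. by rewrite sqr_sqrtr ?dot_ge0. Qed.

Lemma norm2Z x u : 0 <= x -> norm2 (x *: u) = x * norm2 u.
Proof.
by move=> x0; rewrite /norm2 dotZ -expr2 sqrtrM ?sqr_ge0 // sqrtr_sqr ger0_norm.
Qed.

Lemma norm2B_sqr u v : norm2 (u - v) ^+ 2 = dot u u + dot v v - 2 * dot u v.
Proof. by rewrite norm2_sqr !dotE !mxE; ring. Qed.

(* [depth q i] is [z_i = (q_i . q_3) / |q_3|]. *)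
Definition depth q i : R := dot (q i) (q ord_max) / norm2 (q ord_max).

(** Free of square roots, hence a rational function of the coordinates, unlike [depth]. *)
Definition depth2 q i : R :=
  dot (q i) (q ord_max) ^+ 2 / dot (q ord_max) (q ord_max).

Lemma depth_sqr q i : depth q i ^+ 2 = depth2 q i.
Proof. by rewrite expr_div_n norm2_sqr. Qed.

(** Here [b_i z_i^2], [d_i z_j z_k] and [z_i z_3] are [q_i . q_i], [q_j . q_k] and [q_i . q_3], so
    the six equations are laws of cosines with apex at the origin. *)
Lemma depth_eqs q : (forall i, dot (q i) (q ord_max) != 0) ->
  six_equations (coef_a q) (coef_b q) (coef_c q) (coef_d q) (depth q).
Proof.
move=> q3; have q33 := q3 ord_max.
have n0 : norm2 (q ord_max) != 0 by rewrite -sqrf_eq0 norm2_sqr.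
split=> i; rewrite ?/coef_a ?/coef_c norm2B_sqr /coef_b ?/coef_d /depth
  -(norm2_sqr (q ord_max)).
  by field; rewrite n0 !q3.
by field; rewrite n0 !q3.
Qed.

Lemma regular_entry q0 i k : regular_at coords q0 (fun q => q i 0 k).
Proof.
apply: regular_ext (regular_var _ _ (mxvec_index i k)) => q.
by rewrite /coords mxvecE mxE.
Qed.

Lemma regular_dot q0 i j : regular_at coords q0 (fun q => dot (q i) (q j)).
Proof.
apply: (@regular_ext _ _ _ _ _ (fun q => q i 0 0 * q j 0 0 + q i 0 1 * q j 0 1
  + q i 0 2 * q j 0 2)) => [q|]; first by rewrite dotE.
by regular; apply: regular_entry.
Qed.

Section Regularity.
Variable q0 : 'I_4 -> 'rV[R]_3.
Hypothesis q0_dot : forall i, dot (q0 i) (q0 ord_max) != 0.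

Lemma regular_norm2B i j :
  regular_at coords q0 (fun q => norm2 (q i - q j) ^+ 2).
Proof.
apply: (@regular_ext _ _ _ _ _ (fun q => dot (q i) (q i) + dot (q j) (q j)
  - 2 * dot (q i) (q j))) => [q|]; first by rewrite norm2B_sqr.
by regular; apply: regular_dot.
Qed.

Lemma regular_coef_a i : regular_at coords q0 (fun q => coef_a q i).
Proof. exact: regular_norm2B. Qed.

Lemma regular_coef_c i : regular_at coords q0 (fun q => coef_c q i).
Proof. exact: regular_norm2B. Qed.

Lemma regular_coef_b i : regular_at coords q0 (fun q => coef_b q i).
Proof.
apply: regularM; first by regular; apply: regular_dot.
by apply: regularV; rewrite ?expf_neq0 //; regular; apply: regular_dot.
Qed.

Lemma regular_coef_d i : regular_at coords q0 (fun q => coef_d q i).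
Proof.
apply: regularM; first by regular; apply: regular_dot.
by apply: regularV; rewrite ?mulf_neq0 //; regular; apply: regular_dot.
Qed.

Lemma regular_depth2 i : regular_at coords q0 (fun q => depth2 q i).
Proof.
apply: regularM; first by regular; apply: regular_dot.
by apply: regularV => //; apply: regular_dot.
Qed.

Notation separated_at q :=
  (separated (coef_a q) (coef_b q) (coef_c q) (coef_d q) (depth2 q)).

(** Separation at [q0] is used twice: the nonzero leading coefficients make each [other_root]
    regular at [q0], and all the conditions then give regular functions that are nonzero there. *)
Lemma separated_generic :
  separated_at q0 -> generic_at coords q0 (fun q => separated_at q).
Proof.
move=> [h1 h2 h3 h4].
pose X q i j := Xcoef (coef_a q) (coef_b q) (coef_c q) (coef_d q) i j.
have regX i j : regular_at coords q0 (fun q => X q i j).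
  apply: (@regular_Xcoef _ _ _ _ _ (fun i q => coef_a q i)
    (fun i q => coef_b q i) (fun i q => coef_c q i)
    (fun i q => coef_d q i)) => k.
  - exact: regular_coef_a.
  - exact: regular_coef_b.
  - exact: regular_coef_c.
  - exact: regular_coef_d.
have reg_other i : regular_at coords q0 (fun q =>
    other_root (coef_a q) (coef_b q) (coef_c q) (coef_d q) i (depth2 q i)).
  apply: regularD; last by apply: regularN; apply: regular_depth2.
  apply: regularN; apply: (regularM (regX i 1) _).
  exact: (regularV (regX i 2) (h1 i)).
have reg_res i (x y : ('I_4 -> 'rV[R]_3) -> R) :
    regular_at coords q0 x -> regular_at coords q0 y ->
    regular_at coords q0
      (fun q => c_residual (coef_b q) (coef_c q) i (x q) (y q)).
  move=> hx hy; have hb := regular_coef_b i; have hc := regular_coef_c i.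
  by rewrite /c_residual; regular.
have g1 : generic_at coords q0 (fun q => forall i, X q i 2 != 0).
  by apply: generic_forall => i; apply: (generic_neq0 (regX i 2) (h1 i)).
have g2 : generic_at coords q0 (fun q => forall i,
    c_residual (coef_b q) (coef_c q) i (other_root (coef_a q) (coef_b q)
      (coef_c q) (coef_d q) (emb i) (depth2 q (emb i))) (depth2 q ord_max)
    != 0).
  apply: generic_forall => i; have reg := reg_res i _ _ (reg_other (emb i))
    (regular_depth2 ord_max).
  exact: (generic_neq0 reg (h2 i)).
have g3 := generic_neq0 (reg_res 0 _ _ (regular_depth2 (emb 0))
                                     (reg_other ord_max)) h3.
have g4 := generic_neq0 (reg_res 0 _ _ (reg_other (emb 0))
                                     (reg_other ord_max)) h4.
by apply: generic_sub (generic_and (generic_and g1 g2) (generic_and g3 g4))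
  => q [[? ?] [? ?]]; split.
Qed.

End Regularity.

End Configurations.

(** * An integral configuration that is separated *)

Section Witness.
Context {R : realType}.

(* Chosen so that all the [a_i], [b_i], [c_i], [d_i] are integers, with
   [z = (1, 1, 2, 1)] and [d_2 = 0]. *)
Definition witness (i : 'I_4) : 'rV[R]_3 :=
  \row_(k < 3) (nth [::] [:: [:: 1; 1; 1]; [:: 0; -1; 1]; [:: 2; 0; 2];
                            [:: 0; 0; 1]] i)`_k.

Lemma witness_dot3 i : dot (witness i) (witness ord_max) = [:: 1; 1; 2; 1]`_i.
Proof.
rewrite dotE !mxE /=; elim/ord4_cases: i => [i|] /=; last ring.
by elim/ord3_cases: i => /=; ring.
Qed.

Lemma witness_dot i j : dot (witness (emb i)) (witness (emb j)) =
  (nth [::] [:: [:: 3; 0; 4]; [:: 0; 2; 2]; [:: 4; 2; 8]] i)`_j.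
Proof.
rewrite dotE !mxE /=.
by elim/ord3_cases: i => /=; elim/ord3_cases: j => /=; ring.
Qed.

Lemma witness_dot3_neq0 i : dot (witness i) (witness ord_max) != 0.
Proof.
rewrite witness_dot3; elim/ord4_cases: i => [i|]; last exact: oner_neq0.
by elim/ord3_cases: i; rewrite /= ?oner_neq0 ?pnatr_eq0.
Qed.

Lemma witness_coef_a i : coef_a witness i = [:: 6; 3; 5]`_i.
Proof.
rewrite /coef_a norm2B_sqr !witness_dot.
by elim/ord3_cases: i; rewrite !ord3_add /=; ring.
Qed.

Lemma witness_coef_c i : coef_c witness i = [:: 2; 1; 5]`_i.
Proof.
rewrite /coef_c norm2B_sqr witness_dot !witness_dot3.
by elim/ord3_cases: i => /=; ring.
Qed.

Lemma witness_coef_b i : coef_b witness i = [:: 3; 2; 2]`_i.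
Proof.
rewrite /coef_b witness_dot !witness_dot3.
by elim/ord3_cases: i => /=; field.
Qed.

Lemma witness_coef_d i : coef_d witness i = [:: 1; 2; 0]`_i.
Proof.
rewrite /coef_d witness_dot !witness_dot3.
by elim/ord3_cases: i; rewrite !ord3_add /=; field.
Qed.

Lemma witness_depth2 i : depth2 witness i = [:: 1; 1; 4; 1]`_i.
Proof.
rewrite /depth2 !witness_dot3 /= divr1.
elim/ord4_cases: i => [i|] /=; last ring.
by elim/ord3_cases: i => /=; ring.
Qed.

Definition witness_coefE :=
  (witness_coef_a, witness_coef_b, witness_coef_c, witness_coef_d).

Let Xw := Xcoef (coef_a witness) (coef_b witness) (coef_c witness)
  (coef_d witness).

Lemma witness_X_emb i : (Xw (emb i) 1 = [:: - 288; - 112; - 216]`_i) *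
                        (Xw (emb i) 2 = [:: 120; 80; 24]`_i).
Proof.
split; elim/ord3_cases: i;
  rewrite /Xw /Xcoef /X0 /= ?tperm01_ord3 ?tperm02_ord3 !witness_coefE
    /X01 /X02 /=; ring.
Qed.

Lemma witness_X_max : (Xw ord_max 1 = 80) * (Xw ord_max 2 = 16).
Proof.
by split; rewrite /Xw /Xcoef /X3 /= !witness_coefE /X31 /X32 /=; ring.
Qed.

Lemma witness_separated :
  separated (coef_a witness) (coef_b witness) (coef_c witness) (coef_d witness)
    (depth2 witness).
Proof.
split.
- move=> i; rewrite -/(Xw i 2); elim/ord4_cases: i => [i|]; last first.
    by rewrite witness_X_max pnatr_eq0.
  by rewrite witness_X_emb; elim/ord3_cases: i; rewrite pnatr_eq0.
(* The other roots of [Q_0], [Q_1] and [Q_2] are 7/5, 2/5 and 5. *)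
- move=> i; rewrite /c_residual /other_root -/Xw !witness_X_emb !witness_coefE
    !witness_depth2.
  elim/ord3_cases: i => /=.
  + rewrite (_ : _ - _ = - 116 / 25); last by field.
    by rewrite mulf_neq0 ?oppr_eq0 ?invr_eq0 ?pnatr_eq0.
  + rewrite (_ : _ - _ = 24 / 25); last by field.
    by rewrite mulf_neq0 ?invr_eq0 ?pnatr_eq0.
  + by rewrite (_ : _ - _ = - 16) ?oppr_eq0 ?pnatr_eq0 //; field.
(* The other root of [Q_3] is -6; it is paired with the square 1 of [z_0] here and with 7/5 in the
   last case. *)
- rewrite /c_residual /other_root -/Xw !witness_X_max !witness_coefE
    !witness_depth2 /=.
  by rewrite (_ : _ - _ = - 49) ?oppr_eq0 ?pnatr_eq0 //; field.
rewrite /c_residual /other_root -/Xw !witness_X_max !witness_X_emb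
  !witness_coefE !witness_depth2 /=.
rewrite (_ : _ - _ = - 1201 / 25); last by field.
by rewrite mulf_neq0 ?oppr_eq0 ?invr_eq0 ?pnatr_eq0.
Qed.

End Witness.

(** A run involves choices of root order, square roots and minimizer, so existence of a run and
    correctness of every run are separate claims. *)
Theorem corollary5p4 (R : realType) (err : 'rV[R[i]]_(3 + 3) -> R)
    (err_ge0 : forall e, 0 <= err e) (err_eq0 : forall e, err e = 0 <-> e = 0) :
  exists F : {mpoly R[4 * 3]}, F != 0 /\
  forall (P p : 'I_4 -> 'rV[R]_3) (T : 'rV[R]_3 -> 'rV[R]_3),
    (forall i, canvas_point (p i)) ->
    (forall i, dot (p i) (p ord_max) != 0) ->
    rigid_transformation T ->
    (forall i, T (P i) != 0) ->
    (forall i, exists l : R, T (P i) = l *: p i) ->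
    (forall i, 0 < zcoord (T (P i))) ->
    F.@[coords (fun i => T (P i))] != 0 ->
    (exists z : 'I_4 -> R[i], four_point_output err P p z) /\
    (forall z : 'I_4 -> R[i], four_point_output err P p z ->
       forall i, map_mx (real_complex R) (T (P i)) =
                 z i *: map_mx (real_complex R) (p i)).
Proof.
have [F F0 F_sep] :=
  separated_generic (@witness_dot3_neq0 R) witness_separated.
exists F; split; first by apply: contraTneq F0 => ->; rewrite meval0 eqxx.
move=> P p T canvas p3 rigid _ line front /F_sep.
set q := fun i => T (P i) => sep.
(* Since [p i] has third coordinate 1, the factor in [q i = l i *: p i] can only be the third
   coordinate of [q i]. *)
pose l i := zcoord (q i).
have l_gt0 i : 0 < l i := front i.
have l_neq0 i : l i != 0 by rewrite gt_eqF.
have qE i : q i = l i *: p i.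
  have [x qx] := line i; rewrite /l {2}/q qx /zcoord mxE.
  by have := canvas i; rewrite /canvas_point /zcoord => ->; rewrite mulr1.
have q3 i : dot (q i) (q ord_max) != 0.
  by rewrite !qE dotZ !mulf_neq0.
(* [T] preserves distances, and the formulas for [b] and [d] are homogeneous of degree zero in each
   [p i]; hence the input [(P, p)] has the same coefficients as [(q, q)]. *)
have aE : coef_a q = coef_a P.
  by apply: boolp.funext => i; rewrite /coef_a rigid.
have cE : coef_c q = coef_c P.
  by apply: boolp.funext => i; rewrite /coef_c rigid.
have bE : coef_b q = coef_b p.
  apply: boolp.funext => i; rewrite /coef_b !qE !dotZ.
  by field; rewrite ?l_neq0 ?p3.
have dE : coef_d q = coef_d p.
  apply: boolp.funext => i; rewrite /coef_d !qE !dotZ.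
  by field; rewrite ?l_neq0 ?p3.
have norm_p3 : 0 < norm2 (p ord_max).
  by rewrite sqrtr_gt0 lt_def p3 dot_ge0.
have depthE i : depth q i = l i * dot (p i) (p ord_max) / norm2 (p ord_max).
  rewrite /depth !qE norm2Z ?ltW // dotZ; field.
  by rewrite l_neq0 gt_eqF.
have eqs := depth_eqs q3; rewrite aE bE cE dE in eqs sep.
have d2E : depth2 q = (fun i => depth q i ^+ 2).
  by apply: boolp.funext => i; rewrite depth_sqr.
rewrite {}d2E in sep.
(* Being in front of the camera means [l i > 0], so the depth has the sign of [p_i . p_3]. *)
have sgn i : sqrt_sign p i = Num.sg (depth q i).
  rewrite depthE -mulrA sgrM gtr0_sg // mul1r sgrM.
  rewrite (gtr0_sg (x := _^-1)) ?invr_gt0 // mulr1 /sqrt_sign.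
  case: eqP => // ->.
  by rewrite gtr0_sg // lt_def p3 dot_ge0.
have depth_neq0 i : depth q i != 0.
  by rewrite depthE !mulf_neq0 // invr_eq0 gt_eqF.
split; first exact: (four_point_output_exists eqs sep sgn err_ge0 err_eq0).
move=> z hz i.
have := four_point_output_unique eqs sep sgn depth_neq0 err_ge0 err_eq0 hz i.
(* The final rescaling of the algorithm turns the depth back into the factor [l i]. *)
have -> : norm2 (p ord_max) / dot (p i) (p ord_max) * depth q i = l i.
  by rewrite depthE; field; rewrite p3 gt_eqF.
by move=> ->; rewrite -/(q i) qE map_mxZ.
Qed.
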